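(* Let $d \ge 1$, let $A \in \mathbb{R}^{(d+2)\times(d+2)}$ be symmetric positive definite, let $c \in \mathbb{R}^{d+2}$, let $\sigma > 0$, and consider the linear bandit problem on the ellipsoid $\mathcal{X} = \{x \in \mathbb{R}^{d+2} : \|x - c\|_{A^{-1}} \le 1\}$ with Gaussian noise $z_t \sim \mathcal{N}(0,\sigma^2)$. Then for any algorithm, any $B > 0$, any $T \ge 1$ and any $\theta \in \mathcal{E}_A(B) := \{\theta \in \mathbb{R}^{d+2} : \|\theta\|_A = B\}$, there exists $\theta' \in \mathcal{E}_A(B)$ with $$\|\theta - \theta'\|_A^2 \le \min\Big(\frac{\sigma d B}{\sqrt{T}},\, 4B^2\Big)$$ such that the regret of the algorithm on the problem with parameter $\theta'$ satisfies $$R_T(\theta') \ge \min\Big(\frac{\sigma d \sqrt{T}}{16},\, \frac{BT}{4}\Big).$$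
   Context: For a symmetric positive definite matrix $M$, $\|u\|_M := \sqrt{u^\top M u}$. Linear bandit model: the action set $\mathcal{X}$ is known; at each time $t = 1,\dots,T$ the learner chooses $x_t \in \mathcal{X}$ as a (possibly randomized) function of past actions and rewards $y_1,\dots,y_{t-1}$, then observes $y_t = x_t^\top \theta + z_t$, where $\theta$ is an unknown parameter vector and the $z_t$ are independent noise variables. An algorithm is any such (possibly randomized) rule. The regret is $R_T(\theta) := \mathbb{E}\big[\sum_{t=1}^T (x^\star(\theta) - x_t)^\top \theta\big]$, where $x^\star(\theta) \in \arg\max_{x\in\mathcal{X}} x^\top\theta$; for the ellipsoid $\mathcal{X}=\{x:\|x-c\|_{A^{-1}}\le 1\}$ and $\theta\neq 0$, $x^\star(\theta) = c + A\theta/\|\theta\|_A$. *)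

(* Defs.v *)
From HB Require Import structures.
From mathcomp Require Import all_boot all_order all_algebra.
From mathcomp Require Import all_classical all_reals all_analysis.
From mathcomp Require Import normal_distribution.

Set Implicit Arguments.
Unset Strict Implicit.
Unset Printing Implicit Defensive.

Import Order.TTheory GRing.Theory Num.Theory.
Local Open Scope classical_set_scope.
Local Open Scope ring_scope.

Section Bandit.
Context {R : realType} {n : nat}.

Definition dotv (u v : 'cV[R]_n) : R := (u^T *m v) 0 0.

Definition mnorm (M : 'M[R]_n) (u : 'cV[R]_n) : R :=
  Num.sqrt ((u^T *m M *m u) 0 0).

Definition symmetric_mx (M : 'M[R]_n) : Prop := M^T = M.

Definition posdef_mx (M : 'M[R]_n) : Prop :=
  forall u : 'cV[R]_n, u != 0 -> 0 < (u^T *m M *m u) 0 0.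

Definition ellipsoid (A : 'M[R]_n) (c : 'cV[R]_n) : set 'cV[R]_n :=
  [set x | mnorm (invmx A) (x - c) <= 1].

Definition ellA (A : 'M[R]_n) (B : R) : set 'cV[R]_n :=
  [set th | mnorm A th = B].

Definition opt_value (X : set 'cV[R]_n) (th : 'cV[R]_n) : R :=
  sup [set dotv x th | x in X].

Definition gap (X : set 'cV[R]_n) (th x : 'cV[R]_n) : R :=
  opt_value X th - dotv x th.

(* A (possibly randomized) algorithm: an internal random seed u : Omega,
   drawn once from a probability measure mu independently of the noise, and
   a policy that, at (0-based) round k, maps the seed and the k past rewards
   (oldest first) to an action.  Past actions are functions of the seed and
   of the past rewards, hence need not be passed separately. *)
Definition policy (Omega : Type) := forall k : nat, Omega -> k.-tuple R -> 'cV[R]_n.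

Definition policy_measurable d (Omega : measurableType d) (pi : policy Omega) : Prop :=
  forall (k : nat) (i : 'I_n),
    measurable_fun [set: Omega * k.-tuple R] (fun p => pi k p.1 p.2 i 0).

Definition policy_in (Omega : Type) (X : set 'cV[R]_n) (pi : policy Omega) : Prop :=
  forall k u h, X (pi k u h).

(* Expected regret of the remaining m rounds, given the seed u and the
   reward history h of the first k rounds; the noise is z ~ N(0, sigma^2),
   and the observed reward is y = x^T theta + z. *)
Fixpoint regret_from (Omega : Type) (X : set 'cV[R]_n) (pi : policy Omega)
    (sigma : R) (th : 'cV[R]_n) (m k : nat) (u : Omega) (h : k.-tuple R)
    {struct m} : \bar R :=
  match m with
  | 0 => 0%E
  | m'.+1 =>
      let x := pi k u h in
      ((gap X th x)%:E +
       \int[normal_prob 0 sigma]_z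
          @regret_from Omega X pi sigma th m' (k.+1) u [tuple of rcons h (dotv x th + z)%R])%E
  end.

Definition regret d (Omega : measurableType d) (mu : probability Omega R)
    (X : set 'cV[R]_n) (pi : policy Omega) (sigma : R) (T : nat)
    (th : 'cV[R]_n) : \bar R :=
  \int[mu]_u @regret_from _ X pi sigma th T 0 u [tuple].

End Bandit.

(* Main.v *)
Require Import Defs.
From HB Require Import structures.
From mathcomp Require Import all_boot all_order all_algebra.
From mathcomp Require Import all_classical all_reals all_analysis.
From mathcomp Require Import normal_distribution.
From mathcomp Require Import measurable_realfun ring lra.

Import Order.TTheory GRing.Theory Num.Theory.
Local Open Scope classical_set_scope.
Local Open Scope ring_scope.

Set Implicit Arguments.
Unset Strict Implicit.
Unset Printing Implicit Defensive.

(* Take d vectors f_i that are A-orthonormal, A-orthogonal to theta and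
   orthogonal to c, and average the regret over the 2^d parameters
   alpha theta + delta B sum_i (+/- f_i), where alpha^2 + d delta^2 = 1.
   Strong convexity of the ellipsoid bounds the gap at x below by
   B/2 sum_i (v_i -/+ delta)^2 with v_i = f_i . x, while flipping the i-th sign
   shifts the mean reward by only 2 delta B v_i: a small v_i reveals little and
   a large v_i is costly.
   No path measure is needed.  Backward induction on the number of remaining
   rounds bounds sums of regrets weighted by squares P_xi^2, the P_xi^2 playing
   the role of likelihoods: one more reward y multiplies P_xi by the square root
   of its density, and the products P_xi P_xi' of neighbouring weights
   integrate to the Hellinger affinity of two Gaussians.
   Finally delta^2 = sigma / (2 B sqrt T) when this is at most 1/d, and
   delta^2 = 1/d, alpha = 0 otherwise. *)

(** * Integration against Gaussian laws and the affinity of two of them *)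

Section gaussian.
Context {R : realType}.
Local Notation leb := (@lebesgue_measure R).
Implicit Types (a b s : R) (f : R -> \bar R).

Lemma measurable_EFin_normal_pdf a s :
  measurable_fun [set: R] (EFin \o normal_pdf a s).
Proof. by apply/measurable_EFinP; exact: measurable_normal_pdf. Qed.

(** The Radon-Nikodym derivative and [normal_pdf] have the same integral over every measurable set,
    hence agree almost everywhere. *)
Lemma ge0_integral_normal_prob a s f : s != 0 ->
  measurable_fun [set: R] f -> (forall x, 0 <= f x)%E ->
  (\int[normal_prob a s]_x f x = \int[leb]_x (f x * (normal_pdf a s x)%:E))%E.
Proof.
move=> s0 mf f0.
have dom := @normal_prob_dominates R a s.
have mpdf := measurable_EFin_normal_pdf a s.
rewrite -(Radon_Nikodym_SigmaFinite.change_of_variables dom f0 measurableT mf).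
apply: ae_eq_integral => //.
- apply: emeasurable_funM => //.
  exact: measurable_int (Radon_Nikodym_SigmaFinite.f_integrable dom).
- exact: emeasurable_funM.
- apply: ae_eqe_mul2l; apply: integral_ae_eq => //.
    exact: Radon_Nikodym_SigmaFinite.f_integrable dom.
  by move=> E _ mE; rewrite -Radon_Nikodym_SigmaFinite.f_integral.
Qed.

Lemma measurable_fun_addl a :
  @measurable_fun _ _ (measurableTypeR R) (measurableTypeR R) setT (+%R a).
Proof. exact: measurable_funD. Qed.

(** By uniqueness of Lebesgue measure it suffices to compare the two measures on half-open
    intervals. *)
Lemma lebesgue_measure_shift a (E : set R) : measurable E ->
  pushforward leb (+%R a : _ -> measurableTypeR R) E = leb E.
Proof.
move=> mE.
have ms := @measurable_fun_addl a.
pose ms_mixin := @isMeasurableFun.Build _ _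
  (measurableTypeR R) (measurableTypeR R) _ ms.
pose shift : {mfun measurableTypeR R >-> measurableTypeR R} :=
  HB.pack (+%R a : measurableTypeR R -> measurableTypeR R) ms_mixin.
apply/esym; apply: (@lebesgue_measure_unique R (pushforward leb shift)) => //.
move=> _ [[x y]] _ <-; transitivity (leb `](x - a), (y - a)]); last first.
  congr (leb _); apply/seteqP; split => z /=; rewrite !in_itv/=.
    by rewrite ltrBlDl lerBrDl.
  by rewrite ltrBlDl lerBrDl.
rewrite !lebesgue_measure_itv/= !lte_fin ltrD2r.
by case: ifP => // _; rewrite -!EFinB; congr (_%:E); ring.
Qed.
(** Substitution [y = a + z]: from the noise to the observed reward, with [a] the mean reward. *)
Lemma ge0_integral_normal_shift a s f : s != 0 ->
  measurable_fun [set: R] f -> (forall x, 0 <= f x)%E ->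
  (\int[normal_prob 0 s]_z f (a + z)%R =
   \int[leb]_y (f y * (normal_pdf a s y)%:E))%E.
Proof.
move=> s0 mf f0.
have mfa : measurable_fun [set: R] (fun z : R => f (a + z)).
  by apply: measurableT_comp => //; exact: measurable_funD.
rewrite (ge0_integral_normal_prob 0 s0 mfa (fun z => f0 (a + z))).
pose g y := (f y * (normal_pdf a s y)%:E)%E.
have mg : measurable_fun [set: R] g.
  by apply: emeasurable_funM => //; exact: measurable_EFin_normal_pdf.
have g0 y : (0 <= g y)%E by rewrite mule_ge0// lee_fin normal_pdf_ge0.
transitivity (\int[pushforward leb (+%R a : _ -> measurableTypeR R)]_y g y)%E.
  rewrite (@ge0_integral_pushforward _ _ _ _ R _ (measurable_fun_addl a) leb
    setT g measurableT mg (fun y _ => g0 y)).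
  apply: eq_integral => z _; rewrite /g /=; congr (_ * _%:E)%E.
  rewrite !normal_pdfE// /normal_fun subr0 (_ : a + z - a = z)//.
  by rewrite addrC addKr.
apply: eq_measure_integral; first exact: measurable_fun_addl.
by move=> ? E mE _; exact: lebesgue_measure_shift.
Qed.

(* Hellinger affinity of two Gaussians; completing the square around the
   midpoint of the means turns the geometric mean of the densities into a
   multiple of a Gaussian density. *)
Lemma sqrt_normal_pdfM a b s y : s != 0 ->
  Num.sqrt (normal_pdf a s y) * Num.sqrt (normal_pdf b s y) =
  expR (- (a - b) ^+ 2 / (8 * s ^+ 2)) * normal_pdf ((a + b) / 2) s y.
Proof.
move=> s0; rewrite -sqrtrM ?normal_pdf_ge0// !normal_pdfE//.
set p := normal_peak s; have p0 : 0 <= p by exact: normal_peak_ge0.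
rewrite (_ : p * _ * (p * _) = (expR (- (a - b) ^+ 2 / (8 * s ^+ 2)) *
    (p * normal_fun ((a + b) / 2) s y)) ^+ 2).
  by rewrite sqrtr_sqr ger0_norm// !mulr_ge0 ?expR_ge0 ?normal_fun_ge0.
rewrite !exprMn [RHS]mulrCA mulrACA -expr2 /normal_fun; congr (_ * _).
rewrite -!expRM_natl -!expRD; congr expR.
by field.
Qed.

Lemma integral_sqrt_normal_pdfM a b s : s != 0 ->
  (\int[leb]_y (Num.sqrt (normal_pdf a s y) * Num.sqrt (normal_pdf b s y))%:E =
   (expR (- (a - b) ^+ 2 / (8 * s ^+ 2)))%:E)%E.
Proof.
move=> s0; under eq_integral do rewrite sqrt_normal_pdfM// EFinM.
rewrite ge0_integralZl//=.
- by rewrite integral_normal_pdf mule1.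
- exact: measurable_EFin_normal_pdf.
- by move=> y _; rewrite lee_fin normal_pdf_ge0.
Qed.

End gaussian.

(** * Nonnegativity and measurability of the recursive regret *)

Lemma measurable_rcons d1 d2 (T1 : measurableType d1) (T2 : measurableType d2)
    n (f : T1 -> n.-tuple T2) (g : T1 -> T2) :
  measurable_fun [set: T1] f -> measurable_fun [set: T1] g ->
  measurable_fun [set: T1] (fun x => [tuple of rcons (f x) (g x)]).
Proof.
move=> mf mg; apply/measurable_fun_tnthP => i.
have [ilt|ige] := ltnP i n.
- rewrite (_ : _ \o _ = fun x => tnth (f x) (Ordinal ilt)).
    exact: (measurableT_comp (measurable_tnth (Ordinal ilt)) mf).
  apply/funext => x /=; rewrite (tnth_nth (g x)) [RHS](tnth_nth (g x)) /=.
  by rewrite nth_rcons size_tuple ilt.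
- rewrite (_ : _ \o _ = g)//; apply/funext => x /=.
  rewrite (tnth_nth (g x)) /= nth_rcons size_tuple ltnNge ige /=.
  by case: ifP.
Qed.

Section regret.
Context {R : realType} {n : nat} dO (Omega : measurableType dO).
Variables (X : set 'cV[R]_n) (pi : @policy R n Omega) (sigma : R).
Hypotheses (mpi : policy_measurable pi) (piX : policy_in X pi).

Lemma dotvE (u v : 'cV[R]_n) : dotv u v = \sum_i u i 0 * v i 0.
Proof. by rewrite /dotv mxE; apply: eq_bigr => i _; rewrite mxE. Qed.

Lemma regret_from_ge0 th m k u (h : k.-tuple R) :
  (forall x, X x -> 0 <= gap X th x) ->
  (0 <= regret_from X pi sigma th m u h)%E.
Proof.
move=> gap0; elim: m k h => [//|m IH] k h /=.
by apply: adde_ge0; [rewrite lee_fin gap0|exact: integral_ge0].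
Qed.

Lemma measurable_dotv_policy th k :
  measurable_fun [set: Omega * k.-tuple R] (fun p => dotv (pi p.1 p.2) th).
Proof.
under eq_fun do rewrite dotvE.
by apply: measurable_sum => i; apply: measurable_funM => //; exact: mpi.
Qed.

(** Joint measurability in seed and history is what the induction needs: the integral over the next
    reward is then a Tonelli marginal. *)
Lemma measurable_regret_from th m k :
  (forall x, X x -> 0 <= gap X th x) ->
  measurable_fun [set: Omega * k.-tuple R]
    (fun p => regret_from X pi sigma th m p.1 p.2).
Proof.
move=> gap0; elim: m k => [|m IH] k /=; first exact: measurable_cst.
have mdot := @measurable_dotv_policy th k.
apply: emeasurable_funD.
  by apply/measurable_EFinP; apply: measurable_funB.
pose f (q : (Omega * k.-tuple R) * R) := regret_from X pi sigma th m q.1.1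
  [tuple of rcons q.1.2 (dotv (pi q.1.1 q.1.2) th + q.2)].
have mf : measurable_fun setT f.
  pose step (q : (Omega * k.-tuple R) * R) :=
    (q.1.1, [tuple of rcons q.1.2 (dotv (pi q.1.1 q.1.2) th + q.2)]).
  apply: (measurableT_comp (IH k.+1) (g := step)).
  apply: measurable_fun_pair; first exact: measurableT_comp.
  apply: measurable_rcons; first exact: measurableT_comp.
  apply: measurable_funD => //.
  exact: (measurableT_comp mdot measurable_fst).
have f0 q : (0 <= f q)%E by exact: regret_from_ge0.
exact: (@measurable_fun_fubini_tonelli_F _ _ _ _ R (normal_prob 0 sigma) f mf f0).
Qed.

Lemma measurable_regret_from_rcons th m k u (h : k.-tuple R) :
  (forall x, X x -> 0 <= gap X th x) ->
  measurable_fun [set: R]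
    (fun y => regret_from X pi sigma th m u [tuple of rcons h y]).
Proof.
move=> gap0.
have mg : measurable_fun [set: R] (fun y => (u, [tuple of rcons h y])).
  by apply: measurable_fun_pair => //; exact: measurable_rcons.
exact: (measurableT_comp (@measurable_regret_from th m k.+1 gap0) mg).
Qed.

End regret.

(** * Backward induction for weighted sums of regrets *)

Section bayes.
Context {R : realType} {n : nat} dO (Omega : measurableType dO).
Variables (X : set 'cV[R]_n) (pi : @policy R n Omega) (sigma : R).
Hypotheses (mpi : policy_measurable pi) (piX : policy_in X pi).
Hypothesis sigma0 : sigma != 0.
Variables (I J : finType) (nb : J -> I -> I) (th : I -> 'cV[R]_n).
Hypothesis gap0 : forall i x, X x -> 0 <= gap X (th i) x.
Variables (K e : R) (T : nat).
Hypotheses (K0 : 0 <= K) (e0 : 0 <= e).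

(** Minus [rho] is the exponent of the Hellinger affinity between the rewards at [x] under [th i]
    and under its [j]-th neighbour. *)
Let rho i j x : R :=
  (dotv x (th i) - dotv x (th (nb j i))) ^+ 2 / (8 * sigma ^+ 2).

(** Cost against information in one round: [K] is the price of a unit of affinity, [e] a surcharge
    on each gap that is subtracted at the end. The factor [T%:R] lets one round pay for the affinity
    it removes from all later rounds. *)
Hypothesis one_step : forall x (P : I -> R), X x -> (forall i, 0 <= P i) ->
  K * (\sum_i \sum_j P i * P (nb j i) * (1 + T%:R * rho i j x)) <=
  \sum_i P i ^+ 2 * (gap X (th i) x + e).

Let rho0 i j x : 0 <= rho i j x.
Proof. by apply: divr_ge0; [|apply: mulr_ge0 => //]; exact: sqr_ge0. Qed.

(** Since [expR (- r) >= 1 - r], the difference [m.+1 - m * expR (- r)] is at most [1 + m * r],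
    hence at most [1 + T * r]. *)
Let one_step_discount m x (P : I -> R) : (m < T)%N -> X x ->
    (forall i, 0 <= P i) ->
  K * m.+1%:R * (\sum_i \sum_j P i * P (nb j i)) <=
  \sum_i P i ^+ 2 * (gap X (th i) x + e) +
  K * m%:R * (\sum_i \sum_j P i * P (nb j i) * expR (- rho i j x)).
Proof.
move=> mT Xx P0; rewrite -lerBlDr; apply: le_trans (one_step Xx P0).
rewrite -!mulrA -mulrBr ler_wpM2l// !mulr_sumr -sumrB ler_sum// => i _.
rewrite !mulr_sumr -sumrB ler_sum// => j _.
have PP : 0 <= P i * P (nb j i) by rewrite mulr_ge0.
rewrite [m%:R * (_ * _)]mulrCA [m.+1%:R * _]mulrC -mulrBr ler_wpM2l//.
have h1 := expR_ge1Dx (- rho i j x).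
have h2 : m%:R * (1 - rho i j x) <= m%:R * expR (- rho i j x).
  by rewrite ler_wpM2l.
have h3 : m%:R * rho i j x <= T%:R * rho i j x.
  by rewrite ler_wpM2r// ler_nat ltnW.
by rewrite -natr1; lra.
Qed.

(* The [P i ^+ 2] are unnormalised likelihoods of the parameters given the
   history [h]; their square roots make the update by one reward multiplicative
   in [Num.sqrt (normal_pdf _ _ y)]. *)
Lemma weighted_regret_lower_bound m k u (h : k.-tuple R) (P : I -> R) :
  (m <= T)%N -> (forall i, 0 <= P i) ->
  ((K * m%:R * (\sum_i \sum_j P i * P (nb j i)))%:E <=
   \sum_i (P i ^+ 2)%:E *
     (regret_from X pi sigma (th i) m u h + (m%:R * e)%:E))%E.
Proof.
elim: m k h P => [|m IH] k h P mT P0.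
  rewrite mulr0 mul0r; apply: sume_ge0 => i _ /=.
  by rewrite mul0r adde0 mule0.
set x := pi u h.
have Xx : X x by exact: piX.
pose V i y := (regret_from X pi sigma (th i) m u [tuple of rcons h y]
  + (m%:R * e)%:E)%E.
have me0 : (0 <= (m%:R * e)%:E)%E by rewrite lee_fin mulr_ge0.
have V0 i y : (0 <= V i y)%E.
  by apply: adde_ge0 => //; exact: (regret_from_ge0 _ piX _ _ _ (gap0 i)).
have mV i : measurable_fun [set: R] (V i).
  apply: emeasurable_funD => //.
  exact: (measurable_regret_from_rcons sigma mpi piX m u h (gap0 i)).
pose phi i := normal_pdf (dotv x (th i)) sigma.
have phi0 i y : 0 <= phi i y by exact: normal_pdf_ge0.
have mphi i : measurable_fun [set: R] (phi i) by exact: measurable_normal_pdf.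
have mVphi i : measurable_fun [set: R] (fun y => (V i y * (phi i y)%:E)%E).
  by apply: emeasurable_funM => //; exact/measurable_EFinP.
have Vphi0 i y : (0 <= V i y * (phi i y)%:E)%E by rewrite mule_ge0 ?lee_fin.
(* After the shift all parameters integrate over the same Lebesgue measure, so their sum goes under
   one integral. Of the surcharge, one [e] joins the present gap and [m * e] goes into [V]. *)
have stepE i : (regret_from X pi sigma (th i) m.+1 u h + (m.+1%:R * e)%:E =
    (gap X (th i) x + e)%:E +
    \int[@lebesgue_measure R]_y (V i y * (phi i y)%:E))%E.
  rewrite -ge0_integral_normal_shift//= -/x /V.
  rewrite ge0_integralD//=; last 2 first.
  - by move=> z _; exact: (regret_from_ge0 _ piX _ _ _ (gap0 i)).
  - apply: (measurableT_comp
      (measurable_regret_from_rcons sigma mpi piX m u h (gap0 i))).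
    exact: measurable_funD.
  rewrite integral_cst//= probability_setT mule1 -natr1 mulrDl mul1r.
  by rewrite [m%:R * e + e]addrC !EFinD addeACA.
have -> : (\sum_i (P i ^+ 2)%:E *
      (regret_from X pi sigma (th i) m.+1 u h + (m.+1%:R * e)%:E) =
    (\sum_i P i ^+ 2 * (gap X (th i) x + e))%:E +
    \sum_i \int[@lebesgue_measure R]_y
      ((P i ^+ 2)%:E * (V i y * (phi i y)%:E)))%E.
  rewrite -sumEFin -big_split/=; apply: eq_bigr => i _.
  rewrite stepE muleDr ?fin_num_adde_defr// -EFinM; congr (_ + _)%E.
  rewrite ge0_integralZl//; first exact: mVphi.
  by rewrite lee_fin sqr_ge0.
apply: (@le_trans _ _ (\sum_i P i ^+ 2 * (gap X (th i) x + e) +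
  K * m%:R * (\sum_i \sum_j P i * P (nb j i) * expR (- rho i j x)))%:E).
  by rewrite lee_fin; exact: one_step_discount.
rewrite EFinD; apply: leeD2l.
rewrite -ge0_integral_sum//; last 2 first.
- by move=> i; apply: measurable_funeM; exact: mVphi.
- by move=> i y _; rewrite mule_ge0// lee_fin sqr_ge0.
pose Q y i := P i * Num.sqrt (phi i y).
have Q0 y i : 0 <= Q y i by rewrite mulr_ge0// sqrtr_ge0.
pose a (p : I * J) := K * m%:R * (P p.1 * P (nb p.2 p.1)).
have a0 p : 0 <= a p by rewrite /a !mulr_ge0.
pose g (p : I * J) y := Num.sqrt (phi p.1 y) * Num.sqrt (phi (nb p.2 p.1) y).
have g0 p y : 0 <= g p y by rewrite mulr_ge0 ?sqrtr_ge0.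
have mg p : measurable_fun [set: R] (EFin \o g p).
  apply/measurable_EFinP; apply: measurable_funM;
    by apply: measurableT_comp => //; apply: continuous_measurable_fun;
      exact: sqrt_continuous.
have QE y : ((K * m%:R * \sum_i \sum_j Q y i * Q y (nb j i))%:E =
    \sum_p (a p)%:E * (g p y)%:E)%E.
  rewrite -(eq_bigr _ (fun p _ => EFinM (a p) (g p y))) sumEFin pair_bigA/=.
  rewrite mulr_sumr; congr (_%:E); apply: eq_bigr => p _.
  by rewrite /Q /a /g -[RHS]mulrA; congr (_ * _); exact: mulrACA.
apply: (@le_trans _ _ (\int[@lebesgue_measure R]_y
  (\sum_p (a p)%:E * (g p y)%:E))%E); last first.
  apply: ge0_le_integral => //.
  - by move=> y _; apply: sume_ge0 => p _; rewrite mule_ge0// lee_fin.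
  - by apply: emeasurable_sum => p; apply: measurable_funeM; exact: mg.
  - by apply: emeasurable_sum => i; apply: measurable_funeM; exact: mVphi.
  (* For each fixed [y] the induction hypothesis applies to the updated weights [Q y], whose squares
     carry the densities [phi i y]. *)
  - move=> y _; rewrite -QE.
    have := IH _ [tuple of rcons h y] (Q y) (ltnW mT) (Q0 y).
    move=> /le_trans; apply; apply: lee_sum => i _.
    by rewrite /Q exprMn sqr_sqrtr// EFinM -muleA -/(V i y) (muleC (phi i y)%:E).
rewrite ge0_integral_sum//; last 2 first.
- by move=> p; apply: measurable_funeM; exact: mg.
- by move=> p y _; rewrite mule_ge0// lee_fin.
rewrite [X in (_ <= X)%E](eq_bigr
    (fun p => (a p * expR (- rho p.1 p.2 x))%:E)) => [|p _].
  rewrite sumEFin lee_fin pair_bigA/= mulr_sumr ler_sum// => p _.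
  by rewrite mulrA.
rewrite ge0_integralZl//; first last.
- by rewrite lee_fin.
- by move=> y _; rewrite lee_fin.
- exact: mg.
by rewrite integral_sqrt_normal_pdfM// -EFinM /rho mulNr.
Qed.
End bayes.

(** * Inner products and orthogonal vectors *)

Section dotv.
Context {R : realType} {n : nat}.
Implicit Types u v w : 'cV[R]_n.

Lemma dotvC u v : dotv u v = dotv v u.
Proof. by rewrite !dotvE; apply: eq_bigr => i _; rewrite mulrC. Qed.

Lemma dotvDr u v w : dotv u (v + w) = dotv u v + dotv u w.
Proof. by rewrite /dotv mulmxDr mxE. Qed.

Lemma dotvZr a u v : dotv u (a *: v) = a * dotv u v.
Proof. by rewrite /dotv -scalemxAr mxE. Qed.

Lemma dotvNr u v : dotv u (- v) = - dotv u v.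
Proof. by rewrite -scaleN1r dotvZr mulN1r. Qed.

Lemma dotvDl u v w : dotv (v + w) u = dotv v u + dotv w u.
Proof. by rewrite !(dotvC _ u) dotvDr. Qed.

Lemma dotvZl a u v : dotv (a *: v) u = a * dotv v u.
Proof. by rewrite !(dotvC _ u) dotvZr. Qed.

Lemma dotvNl u v : dotv (- v) u = - dotv v u.
Proof. by rewrite !(dotvC _ u) dotvNr. Qed.

Lemma dotv_sumr (I : Type) (r : seq I) (F : I -> 'cV[R]_n) u :
  dotv u (\sum_(i <- r) F i) = \sum_(i <- r) dotv u (F i).
Proof. by rewrite /dotv mulmx_sumr summxE. Qed.

Lemma dotv_suml (I : Type) (r : seq I) (F : I -> 'cV[R]_n) u :
  dotv (\sum_(i <- r) F i) u = \sum_(i <- r) dotv (F i) u.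
Proof. by rewrite dotvC dotv_sumr; apply: eq_bigr => i _; exact: dotvC. Qed.

(** A matrix with [n] rows and fewer columns has a nonzero left kernel. *)
Lemma exists_orthogonal (s : seq 'cV[R]_n) : (size s < n)%N ->
  exists2 f, f != 0 & forall u, u \in s -> dotv f u = 0.
Proof.
move=> sn.
pose M : 'M[R]_(n, size s) := \matrix_(i, j) (tnth (in_tuple s) j) i 0.
have : kermx M != 0.
  by rewrite -mxrank_eq0 mxrank_ker subn_eq0 -ltnNge (leq_ltn_trans (rank_leq_col _)).
move=> /rowV0Pn[v /sub_kermxP vM v0]; exists v^T.
  by apply: contra v0 => /eqP/(congr1 trmx); rewrite trmxK trmx0 => ->.
move=> u /(nthP 0)[j js <-].
have /matrixP/(_ 0 (Ordinal js)) := vM.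
rewrite !mxE dotvE => vM0; rewrite -[RHS]vM0; apply: eq_bigr => i _.
by rewrite !mxE (tnth_nth 0).
Qed.

End dotv.

(** * The form of [A] and the geometry of the ellipsoid *)

Section form.
Context {R : realType} {n : nat} (A : 'M[R]_n).
Hypotheses (Asym : symmetric_mx A) (Apd : posdef_mx A).
Local Notation ip u v := (dotv u (A *m v)).

Lemma form_sym u v : (ip u v) = (ip v u).
Proof.
by rewrite dotvC /dotv trmx_mul Asym -mulmxA.
Qed.

Lemma form_mnorm u : mnorm A u = Num.sqrt (ip u u).
Proof. by rewrite /mnorm /dotv mulmxA. Qed.

Lemma form_gt0 u : u != 0 -> 0 < (ip u u).
Proof. by move=> /Apd; rewrite /dotv mulmxA. Qed.

Lemma form_ge0 u : 0 <= (ip u u).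
Proof.
have [->|/form_gt0/ltW//] := eqVneq u 0.
by rewrite mulmx0 -[X in dotv _ X](scale0r 0) dotvZr mul0r.
Qed.

Lemma mnorm_sqr u : mnorm A u ^+ 2 = (ip u u).
Proof. by rewrite form_mnorm sqr_sqrtr// form_ge0. Qed.

Lemma posdef_unitmx : A \in unitmx.
Proof.
rewrite -row_free_unit -kermx_eq0; apply: contraT => /rowV0Pn[v].
move=> /sub_kermxP vA v0.
have vT0 : v^T != 0.
  by apply: contra v0 => /eqP/(congr1 trmx); rewrite trmxK trmx0 => ->.
by have := Apd vT0; rewrite trmxK vA mul0mx mxE ltxx.
Qed.

(** Induction on [d]: being orthogonal to the vectors [A *m f i] is being A-orthogonal to the [f i],
    so [exists_orthogonal] yields the next vector up to normalization. *)
Lemma exists_orthonormal (s : seq 'cV[R]_n) d : (size s + d <= n)%N ->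
  exists f : nat -> 'cV[R]_n,
    (forall i j, (i < d)%N -> (j < d)%N -> (ip (f i) (f j)) = (i == j)%:R) /\
    (forall i u, (i < d)%N -> u \in s -> dotv (f i) u = 0).
Proof.
elim: d => [|d IH] sd; first by exists (fun=> 0).
have [f [fon fs]] := IH (leq_trans (leq_add (leqnn _) (leqnSn d)) sd).
pose t := s ++ [seq A *m f i | i <- iota 0 d].
have [|g g0 gt] := @exists_orthogonal R n t.
  by rewrite size_cat size_map size_iota -addnS.
have gs u : u \in s -> dotv g u = 0.
  by move=> us; apply: gt; rewrite mem_cat us.
have gf i : (i < d)%N -> (ip g (f i)) = 0.
  move=> id; apply: gt; rewrite mem_cat; apply/orP; right.
  by apply: map_f; rewrite mem_iota.
have gg := form_gt0 g0; set r := Num.sqrt (ip g g).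
have r0 : r != 0 by rewrite sqrtr_eq0 -ltNge.
pose g' := r^-1 *: g.
have gf' i : (i < d)%N -> (ip g' (f i)) = 0.
  by move=> id; rewrite dotvZl gf// mulr0.
have gg' : (ip g' g') = 1.
  rewrite dotvZl -scalemxAr dotvZr -[X in _ * (_ * X)]sqr_sqrtr ?ltW// -/r.
  by field.
exists (fun i => if i == d then g' else f i); split => [i j|i u].
  rewrite !ltnS => id jd; have [->|nid] := eqVneq i d.
    have [_|njd] := eqVneq j d; first by [].
    by rewrite gf' ?ltn_neqAle ?njd.
  have [->|njd] := eqVneq j d.
    by rewrite form_sym gf' ?(negbTE nid)// ltn_neqAle nid.
  by rewrite fon// ltn_neqAle ?nid ?njd.
rewrite ltnS => id us; have [_|nid] := eqVneq i d.
  by rewrite dotvZl gs// mulr0.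
by rewrite fs// ltn_neqAle nid.
Qed.

(** The form is nonnegative at [z - p], with [p] the projection of [z] to the span of the [f i]. *)
Lemma bessel d (f : 'I_d -> 'cV[R]_n) z :
  (forall i j, (ip (f i) (f j)) = (i == j)%:R) ->
  \sum_i (ip (f i) z) ^+ 2 <= (ip z z).
Proof.
move=> fon; pose p := \sum_i (ip (f i) z) *: f i.
have fp i : (ip (f i) p) = (ip (f i) z).
  rewrite mulmx_sumr dotv_sumr (bigD1 i)//= big1 => [|j ji].
    by rewrite addr0 -scalemxAr dotvZr fon eqxx mulr1.
  by rewrite -scalemxAr dotvZr fon eq_sym (negbTE ji) mulr0.
have pE w : (ip p w) = \sum_i (ip (f i) z) * (ip (f i) w).
  by rewrite dotv_suml; apply: eq_bigr => i _; rewrite dotvZl.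
have pz : ip p z = \sum_i (ip (f i) z) ^+ 2.
  by rewrite pE; apply: eq_bigr => i _; rewrite expr2.
have pp : ip p p = \sum_i (ip (f i) z) ^+ 2.
  by rewrite pE; apply: eq_bigr => i _; rewrite fp expr2.
have := form_ge0 (z - p).
by rewrite mulmxBr dotvDl !dotvNl !dotvDr !dotvNr (form_sym z p) pz pp; lra.
Qed.

(** The coordinate [w = invmx A *m (x - c)] replaces the norm of [invmx A] by that of [A]. *)
Lemma ellipsoid_form c x :
  ellipsoid A c x <-> exists2 w, x = c + A *m w & ip w w <= 1.
Proof.
have AU := posdef_unitmx.
have wE w : ((c + A *m w - c)^T *m invmx A *m (c + A *m w - c)) 0 0 = ip w w.
  rewrite addrC addKr trmx_mul Asym -[_ *m A *m _]mulmxA mulmxV// mulmx1.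
  by rewrite mulmxA /dotv mulmxA.
have xE x' : x' = c + A *m (invmx A *m (x' - c)).
  by rewrite mulmxA mulmxV// mul1mx addrC subrK.
rewrite /ellipsoid /= /mnorm; split => [|[w -> w1]].
  rewrite {1 2}(xE x) wE => ww; exists (invmx A *m (x - c)) => //.
  rewrite -(sqr_sqrtr (form_ge0 _)) expr_le1// sqrtr_ge0.
by rewrite wE -sqrtr1 ler_sqrt.
Qed.

(** Strong convexity: on expanding the square, the two sides differ by [B / 2 * (1 - ip w w)]. *)
Lemma form_le_unit w th (B : R) : 0 < B -> ip w w <= 1 -> ip th th = B ^+ 2 ->
  B / 2 * ip (w - B^-1 *: th) (w - B^-1 *: th) <= B - ip w th.
Proof.
move=> B0 w1 thB.
rewrite mulmxBr dotvDl !dotvNl !dotvDr !dotvNr -!scalemxAr !dotvZr !dotvZl.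
rewrite (form_sym th w) thB.
have -> : B / 2 * (ip w w - B^-1 * ip w th - (B^-1 * ip w th - B^-1 * (B^-1 * B ^+ 2)))
  = B / 2 * ip w w + B / 2 - ip w th by field; rewrite gt_eqF.
nra.
Qed.

Lemma ellipsoid_gap c th x w (B : R) : 0 < B -> ip th th = B ^+ 2 ->
  ip w w <= 1 -> x = c + A *m w -> B - ip w th <= gap (ellipsoid A c) th x.
Proof.
move=> B0 thB w1 xw.
have Bge w' : ip w' w' <= 1 -> ip w' th <= B.
  move=> w'1; rewrite -subr_ge0; apply: le_trans (form_le_unit B0 w'1 thB).
  by rewrite mulr_ge0 ?form_ge0// divr_ge0// ltW.
have dE w' : dotv (c + A *m w') th = dotv c th + ip w' th.
  by rewrite dotvDl form_sym [X in _ + X]dotvC.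
rewrite /gap xw dE opprD addrA lerD2r lerBrDr addrC.
apply: sup_upper_bound.
  (* [sup] dominates the values only if their set is nonempty and bounded above. The maximizer has
     coordinate [w = B^-1 *: th]. *)
  split; first by exists (dotv x th), x => //; apply/ellipsoid_form; exists w.
  exists (dotv c th + B) => _ [_ /ellipsoid_form[w' -> w'1] <-].
  by rewrite dE lerD2l Bge.
exists (c + A *m (B^-1 *: th)).
  apply/ellipsoid_form; exists (B^-1 *: th) => //.
  rewrite -scalemxAr dotvZr dotvZl thB.
  have -> : B^-1 * (B^-1 * B ^+ 2) = 1 by field; rewrite gt_eqF.
  by [].
rewrite dE dotvZl thB; congr (_ + _).
by field; rewrite gt_eqF.
Qed.

End form.

(** * A quadratic inequality and a mean-value argument *)

Section elementary.
Context {R : realType}.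

(* As a quadratic form in (p, q) the difference of the two sides has negative
   discriminant. *)
Lemma two_point_quadratic (p q v D : R) : D != 0 ->
  p * q * (2 * D ^+ 2 + v ^+ 2 / 4) <=
  p ^+ 2 * ((v - D) ^+ 2 + D ^+ 2 / 2) + q ^+ 2 * ((v + D) ^+ 2 + D ^+ 2 / 2).
Proof.
move=> D0; have DD : 0 < D ^+ 2 by rewrite exprn_even_gt0.
set a := (v - D) ^+ 2 + _; set b := (v + D) ^+ 2 + _; set k := 2 * _ + _.
have a0 : 0 < a by rewrite ltr_wpDl ?sqr_ge0// divr_gt0.
have disc : k ^+ 2 <= 4 * (a * b).
  rewrite -subr_ge0.
  (* Completing the square in [v ^+ 2]. *)
  have -> : 4 * (a * b) - k ^+ 2 = 63 / 16 * (v ^+ 2 - 40 / 63 * D ^+ 2) ^+ 2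
      + 215 / 63 * (D ^+ 2) ^+ 2 by rewrite /a /b /k; field.
  by rewrite addr_ge0// mulr_ge0// ?sqr_ge0// divr_ge0.
rewrite -subr_ge0 -(pmulr_rge0 _ a0).
have -> : a * (p ^+ 2 * a + q ^+ 2 * b - p * q * k) =
  (a * p - k / 2 * q) ^+ 2 + (4 * (a * b) - k ^+ 2) / 4 * q ^+ 2 by field.
by rewrite addr_ge0 ?sqr_ge0// mulr_ge0 ?sqr_ge0// divr_ge0// subr_ge0.
Qed.

(** Were every [F i] below [v], all would be finite and their sum strictly below [#|I| * v]. *)
Lemma exists_ge_mean (I : finType) (F : I -> \bar R) (v : R) : (0 < #|I|)%N ->
  (forall i, 0 <= F i)%E -> ((#|I|%:R * v)%:E <= \sum_i F i)%E ->
  exists i, (v%:E <= F i)%E.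
Proof.
move=> I0 F0 vF; apply: contrapT => /forallNP nF.
have Flt i : (F i < v%:E)%E by rewrite ltNge; apply/negP; exact: nF.
have Ffin i : F i = (fine (F i))%:E.
  by rewrite fineK// ge0_fin_numE// (lt_le_trans (Flt i))// leey.
move: vF; under eq_bigr do rewrite Ffin; rewrite sumEFin lee_fin leNgt.
move/negP; apply.
have -> : #|I|%:R * v = \sum_(i : I) v by rewrite sumr_const mulr_natl.
move/card_gt0P : I0 => [i0 _].
by apply: ltr_sum; [apply/hasP; exists i0|move=> i _;
  rewrite -lte_fin -Ffin].
Qed.

End elementary.

(** * The hypercube of hard parameters *)

Definition flip d (j : 'I_d) (xi : {ffun 'I_d -> bool}) : {ffun 'I_d -> bool} :=
  [ffun i => if i == j then ~~ xi i else xi i].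

Lemma flipK d (j : 'I_d) : involutive (flip j).
Proof.
by move=> xi; apply/ffunP => i; rewrite !ffunE; case: eqP => //; rewrite negbK.
Qed.

Section hypercube.
Context {R : realType} {n : nat} (A : 'M[R]_n).
Hypotheses (Asym : symmetric_mx A) (Apd : posdef_mx A).
Local Notation ip u v := (dotv u (A *m v)).
Variables (c theta : 'cV[R]_n) (d : nat) (f : 'I_d -> 'cV[R]_n).
Variables (B sigma alpha delta : R) (T : nat).
Hypotheses (B0 : 0 < B) (sigma0 : 0 < sigma) (delta0 : 0 < delta).
Hypotheses (thetaB : ip theta theta = B ^+ 2)
  (fon : forall i j, ip (f i) (f j) = (i == j)%:R)
  (fth : forall i, ip (f i) theta = 0) (fc : forall i, dotv (f i) c = 0)
  (alphadelta : alpha ^+ 2 + d%:R * delta ^+ 2 = 1)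
  (deltaT : 4 * delta ^+ 4 * B ^+ 2 * T%:R <= sigma ^+ 2).

Let sg (b : bool) : R := (-1) ^+ b.

Let sg_sqr b : sg b ^+ 2 = 1. Proof. by rewrite /sg sqrr_sign. Qed.

Definition vertex (xi : {ffun 'I_d -> bool}) : 'cV[R]_n :=
  alpha *: theta + (delta * B) *: \sum_i (-1) ^+ xi i *: f i.

Let fsum xi j : ip (f j) (\sum_i sg (xi i) *: f i) = sg (xi j).
Proof.
rewrite mulmx_sumr dotv_sumr (bigD1 j)//= big1 => [|i ij].
  by rewrite addr0 -scalemxAr dotvZr fon eqxx mulr1.
by rewrite -scalemxAr dotvZr fon eq_sym (negbTE ij) mulr0.
Qed.

Let f_vertex xi i : ip (f i) (vertex xi) = delta * B * sg (xi i).
Proof.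
by rewrite /vertex mulmxDr dotvDr -!scalemxAr !dotvZr fth fsum mulr0 add0r.
Qed.

Let theta_vertex xi : ip theta (vertex xi) = alpha * B ^+ 2.
Proof.
rewrite /vertex mulmxDr dotvDr -!scalemxAr !dotvZr thetaB mulmx_sumr dotv_sumr.
rewrite big1 ?mulr0 ?addr0// => i _.
by rewrite -scalemxAr dotvZr form_sym// fth mulr0.
Qed.

Lemma form_vertex xi : ip (vertex xi) (vertex xi) = B ^+ 2.
Proof.
rewrite {1}/vertex dotvDl !dotvZl theta_vertex dotv_suml.
under eq_bigr do rewrite dotvZl f_vertex -/(sg _) mulrCA -expr2 sg_sqr mulr1.
rewrite sumr_const card_ord -[_ *+ d]mulr_natl.
transitivity ((alpha ^+ 2 + d%:R * delta ^+ 2) * B ^+ 2); first by ring.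
by rewrite alphadelta mul1r.
Qed.

Lemma vertex_dist xi :
  ip (theta - vertex xi) (theta - vertex xi) = 2 * B ^+ 2 * (1 - alpha).
Proof.
rewrite mulmxBr dotvDl !dotvNl !dotvDr !dotvNr form_vertex theta_vertex.
rewrite (form_sym Asym (vertex xi)) theta_vertex thetaB; ring.
Qed.

Let vertex_flip xi i x :
  dotv x (vertex xi) - dotv x (vertex (flip i xi)) =
  2 * delta * B * sg (xi i) * dotv (f i) x.
Proof.
rewrite /vertex !dotvDr !dotvZr opprD addrACA subrr add0r -mulrBr.
rewrite !dotv_sumr -sumrB (bigD1 i)//= big1 => [|j ji].
  rewrite addr0 !dotvZr ffunE eqxx (dotvC x) /sg.
  by case: (xi i); rewrite ?expr1 ?expr0; ring.
by rewrite ffunE (negbTE ji) subrr.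
Qed.

(** With this value [2 * K] and [K / 2] are [B / 2] times the terms [2 * D ^+ 2] and [D ^+ 2 / 2] of
    [two_point_quadratic], where [D ^+ 2 = delta ^+ 2]. *)
Let K := B * delta ^+ 2 / 2.

(** Bessel's inequality bounds the strong convexity term below; as [f i] is orthogonal to [c], its
    coefficient on [w] is [dotv (f i) x]. *)
Let vertex_gap (xi : {ffun 'I_d -> bool}) x w : ip w w <= 1 -> x = c + A *m w ->
  B / 2 * \sum_i (dotv (f i) x - delta * sg (xi i)) ^+ 2 <=
  gap (ellipsoid A c) (vertex xi) x.
Proof.
move=> w1 xw.
apply: le_trans (ellipsoid_gap Asym Apd B0 (form_vertex xi) w1 xw).
apply: le_trans (form_le_unit Asym B0 w1 (form_vertex xi)).
apply: ler_wpM2l; first by rewrite divr_ge0// ltW.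
apply: le_trans (bessel Asym Apd _ fon); rewrite ler_sum// => i _.
rewrite mulmxBr dotvDr dotvNr -scalemxAr dotvZr f_vertex xw dotvDr fc add0r.
by rewrite mulrA mulrCA mulVf ?gt_eqF// mulr1.
Qed.

Let vertex_gap_ge0 (xi : {ffun 'I_d -> bool}) x : ellipsoid A c x ->
  0 <= gap (ellipsoid A c) (vertex xi) x.
Proof.
move=> /(ellipsoid_form Asym Apd)[w xw w1]; apply: le_trans (vertex_gap _ w1 xw).
apply: mulr_ge0; first by rewrite divr_ge0// ltW.
by apply: sumr_ge0 => i _; exact: sqr_ge0.
Qed.

(** The inequality splits over the coordinates [i], each with a share [K / 2] of the surcharge, and
    then over the pairs [xi], [flip i xi]. *)
Let one_step x (P : {ffun 'I_d -> bool} -> R) :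
  ellipsoid A c x -> (forall xi, 0 <= P xi) ->
  K * (\sum_xi \sum_i P xi * P (flip i xi) * (1 + T%:R *
    ((dotv x (vertex xi) - dotv x (vertex (flip i xi))) ^+ 2 /
     (8 * sigma ^+ 2)))) <=
  \sum_xi P xi ^+ 2 * (gap (ellipsoid A c) (vertex xi) x + K * d%:R / 2).
Proof.
move=> /(ellipsoid_form Asym Apd)[w xw w1] P0.
pose F i xi :=
  P xi ^+ 2 * (B / 2 * (dotv (f i) x - delta * sg (xi i)) ^+ 2 + K / 2).
apply: (@le_trans _ _ (\sum_(xi : {ffun 'I_d -> bool}) \sum_i F i xi)); last first.
  rewrite ler_sum// => xi _; rewrite -mulr_sumr ler_wpM2l ?sqr_ge0//.
  rewrite big_split/= -mulr_sumr sumr_const card_ord -[_ *+ d]mulr_natr.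
  rewrite [K / 2 * _]mulrAC lerD2r; exact: (vertex_gap _ w1 xw).
rewrite mulr_sumr; under eq_bigr do rewrite mulr_sumr.
rewrite exchange_big [leRHS]exchange_big/= ler_sum// => i _.
(* Doubling and reindexing one copy by the flip brings both members of a pair into each summand. *)
rewrite -(ler_pM2l (_ : 0 < 2))// [leRHS]mulr_natl mulr2n.
rewrite [X in _ <= _ + X](reindex_inj (can_inj (flipK i))) -big_split/=.
rewrite mulr_sumr ler_sum// => xi _.
rewrite vertex_flip /F.
have -> : sg (flip i xi i) = - sg (xi i).
  by rewrite ffunE eqxx /sg; case: (xi i); rewrite ?expr0 ?expr1 ?opprK.
set v := dotv (f i) x; set s := sg _.
have ss : s ^+ 2 = 1 by exact: sg_sqr.
have D0 : delta * s != 0.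
  rewrite mulf_neq0//; first by rewrite gt_eqF.
  by rewrite -sqrf_eq0 ss oner_neq0.
have PP : 0 <= P xi * P (flip i xi) by rewrite mulr_ge0.
have quad := two_point_quadratic (P xi) (P (flip i xi)) v D0.
have sig2 : 0 < sigma ^+ 2 by rewrite exprn_gt0.
(* [deltaT] keeps the information gained over T rounds below the cost in v^2. *)
have info : 2 * K * (T%:R * ((2 * delta * B * s * v) ^+ 2 / (8 * sigma ^+ 2)))
    <= B / 2 * (v ^+ 2 / 4).
  rewrite !exprMn ss mulr1 /K.
  have -> : 2 * (B * delta ^+ 2 / 2) * (T%:R * (2 ^+ 2 * delta ^+ 2 * B ^+ 2
      * v ^+ 2 / (8 * sigma ^+ 2))) = B / 2 * (v ^+ 2 / 4) *
      ((4 * delta ^+ 4 * B ^+ 2 * T%:R) / sigma ^+ 2).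
    by field; rewrite gt_eqF.
  rewrite ler_piMr ?ler_pdivrMr ?mul1r//.
  by rewrite mulr_ge0 ?divr_ge0 ?sqr_ge0 ?ltW.
have info' := ler_wpM2l PP info.
have B2 : 0 <= B / 2 by rewrite divr_ge0 ?ltW.
have quad' := ler_wpM2l B2 quad.
move: info' quad'; rewrite !(exprMn _ delta s) ss /K mulrN opprK.
lra.
Qed.

(** Unit initial weights give [K * T * d] per vertex, of which the surcharge takes back half; some
    vertex reaches the mean. *)
Lemma hypercube_regret dO (Omega : measurableType dO)
    (mu : probability Omega R) (pi : policy Omega) :
  policy_measurable pi -> policy_in (ellipsoid A c) pi ->
  exists xi, ((T%:R * B * delta ^+ 2 * d%:R / 4)%:E <=
    regret mu (ellipsoid A c) pi sigma T (vertex xi))%E.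
Proof.
move=> mpi piX; set X := ellipsoid A c.
have K0 : 0 <= K.
  by apply: divr_ge0 => //; apply: mulr_ge0; rewrite ?sqr_ge0// ltW.
have e0 : 0 <= K * d%:R / 2.
  by apply: divr_ge0 => //; apply: mulr_ge0.
pose W xi u := regret_from X pi sigma (vertex xi) T u [tuple].
have W0 xi u : (0 <= W xi u)%E.
  by apply: regret_from_ge0 => // x; exact: vertex_gap_ge0.
have mW xi : measurable_fun [set: Omega] (W xi).
  have mu0 : measurable_fun [set: Omega] (fun u => (u, [tuple] : 0.-tuple R)).
    by apply: measurable_fun_pair => //; exact: measurable_cst.
  exact: (measurableT_comp (@measurable_regret_from R n dO Omega X pi sigma
    mpi piX (vertex xi) T 0 (vertex_gap_ge0 xi)) mu0).
apply: exists_ge_mean.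
- by apply/card_gt0P; exists [ffun=> true].
- by move=> xi; apply: integral_ge0 => u _; exact: (W0 xi u).
rewrite /regret -(@ge0_integral_sum _ _ _ mu setT measurableT _ W mW
  (fun xi u _ => W0 xi u)).
set V := _%:E.
have -> : V = (\int[mu]_u V)%E by rewrite integral_cst//= probability_setT mule1.
have V0 : (0 <= V)%E.
  rewrite lee_fin; apply: mulr_ge0 => //; apply: divr_ge0 => //.
  apply: mulr_ge0 => //.
  apply: mulr_ge0; last exact: sqr_ge0.
  by apply: mulr_ge0 => //; exact: ltW.
apply: ge0_le_integral => //; first exact: emeasurable_sum.
move=> u _.
have sigman0 : sigma != 0 by rewrite gt_eqF.
have lb := @weighted_regret_lower_bound R n dO Omega X pi sigma mpi piX sigman0
  _ _ (@flip d) vertex vertex_gap_ge0 K (K * d%:R / 2) T K0 e0 one_step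
  T 0 u [tuple] (fun=> 1) (leqnn T) (fun=> ler01).
pose E : R := \sum_(xi : {ffun 'I_d -> bool}) (T%:R * (K * d%:R / 2)).
rewrite -(leeD2rE _ _ (_ : E%:E \is a fin_num))//.
apply: le_trans (le_trans lb _); last first.
  rewrite -sumEFin -big_split/=; apply: lee_sum => xi _.
  by rewrite expr1n mul1e.
have sumd (r : R) : \sum_(i < d) r = d%:R * r.
  by rewrite sumr_const card_ord mulr_natl.
have sumN (r : R) : \sum_(xi : {ffun 'I_d -> bool}) r =
    #|{: {ffun 'I_d -> bool}}|%:R * r by rewrite sumr_const mulr_natl.
rewrite -EFinD lee_fin /E sumd !sumN /K le_eqVlt.
by apply/orP; left; apply/eqP; field.
Qed.

End hypercube.

(** * Choice of [alpha] and [delta] *)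

Theorem theorem1 (R : realType) (d : nat) (hd : (1 <= d)%N)
  (A : 'M[R]_(d.+2)) (hAsym : symmetric_mx A) (hApd : posdef_mx A)
  (c : 'cV[R]_(d.+2)) (sigma : R) (hsigma : 0 < sigma)
  (dO : measure_display) (Omega : measurableType dO)
  (mu : probability Omega R) (pi : policy Omega)
  (hpi_meas : policy_measurable pi)
  (hpi_in : policy_in (ellipsoid A c) pi)
  (B : R) (hB : 0 < B) (T : nat) (hT : (1 <= T)%N)
  (th : 'cV[R]_(d.+2)) (hth : ellA A B th) :
  exists th' : 'cV[R]_(d.+2),
    [/\ ellA A B th',
        mnorm A (th - th') ^+ 2
          <= Num.min (sigma * d%:R * B / Num.sqrt T%:R) (4 * B ^+ 2)
      & (regret mu (ellipsoid A c) pi sigma T th'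
          >= (Num.min (sigma * d%:R * Num.sqrt T%:R / 16) (B * T%:R / 4))%:E)%E].
Proof.
have thB : dotv th (A *m th) = B ^+ 2 by rewrite -mnorm_sqr// hth.
(* The two constraints [A *m th] and [c] leave room for [d] vectors in dimension [d.+2]. *)
have [|f [fon fs]] := @exists_orthonormal R _ A hAsym hApd [:: A *m th; c] d.
  by [].
pose g (i : 'I_d) := f i.
have gon i j : dotv (g i) (A *m g j) = (i == j)%:R by rewrite fon.
have gth i : dotv (g i) (A *m th) = 0 by rewrite fs// inE eqxx.
have gc i : dotv (g i) c = 0 by rewrite fs// !inE eqxx orbT.
have d0 : 0 < d%:R :> R by rewrite ltr0n.
set t := Num.sqrt T%:R.
have t0 : 0 < t by rewrite sqrtr_gt0 ltr0n.
have tE : T%:R = t ^+ 2 by rewrite sqr_sqrtr.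
have core (alpha delta : R) : 0 <= alpha -> 0 < delta ->
    alpha ^+ 2 + d%:R * delta ^+ 2 = 1 ->
    4 * delta ^+ 4 * B ^+ 2 * T%:R <= sigma ^+ 2 ->
    2 * B ^+ 2 * (1 - alpha) <= sigma * d%:R * B / t ->
    Num.min (sigma * d%:R * t / 16) (B * T%:R / 4) <=
      T%:R * B * delta ^+ 2 * d%:R / 4 ->
    exists th' : 'cV[R]_(d.+2),
    [/\ ellA A B th',
        mnorm A (th - th') ^+ 2 <=
          Num.min (sigma * d%:R * B / t) (4 * B ^+ 2)
      & (regret mu (ellipsoid A c) pi sigma T th'
          >= (Num.min (sigma * d%:R * t / 16) (B * T%:R / 4))%:E)%E].
  move=> alpha0 delta0 ad deltaT dist val.
  have [xi xiP] := hypercube_regret hAsym hApd hB hsigma delta0 thB gon gth gc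
    ad deltaT mu hpi_meas hpi_in.
  exists (vertex th g B alpha delta xi); split.
  - rewrite /ellA /= form_mnorm.
    by rewrite (form_vertex hAsym thB gon gth ad) sqrtr_sqr ger0_norm// ltW.
  - rewrite mnorm_sqr// (vertex_dist hAsym thB gon gth ad) le_min dist/=.
    have : 0 <= B ^+ 2 by rewrite sqr_ge0.
    nra.
  - by apply: le_trans xiP; rewrite lee_fin.
(* [small] says that [delta ^+ 2 = sigma / (2 * B * t)] satisfies [d * delta ^+ 2 <= 1], so that
   [alpha] exists. *)
have [small|large] := leP (sigma * d%:R) (2 * B * t).
- have q0 : 0 < sigma / (2 * B * t) by rewrite divr_gt0 ?mulr_gt0.
  have q1 : d%:R * (sigma / (2 * B * t)) <= 1.
    by rewrite mulrA ler_pdivrMr ?mulr_gt0// mul1r mulrC.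
  set q := sigma / _ in q0 q1.
  have a0 : 0 <= 1 - d%:R * q by rewrite subr_ge0.
  have dqE : Num.sqrt q ^+ 2 = q by rewrite sqr_sqrtr// ltW.
  have alE : Num.sqrt (1 - d%:R * q) ^+ 2 = 1 - d%:R * q by rewrite sqr_sqrtr.
  have Bqt : 2 * B * t * q = sigma by rewrite /q; field; rewrite !gt_eqF.
  apply: (core (Num.sqrt (1 - d%:R * q)) (Num.sqrt q)).
  + exact: sqrtr_ge0.
  + by rewrite sqrtr_gt0.
  + by rewrite dqE alE subrK.
  + rewrite (exprM _ 2 2) dqE tE -Bqt le_eqVlt; apply/orP; left; apply/eqP.
    ring.
  (* As [alpha] lies in [0, 1], [1 - alpha <= 1 - alpha ^+ 2 = d * q]. *)
  + have -> : sigma * d%:R * B / t = 2 * B ^+ 2 * (d%:R * q).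
      by rewrite -Bqt; field; rewrite gt_eqF.
    have al0 := sqrtr_ge0 (1 - d%:R * q).
    have al1 : Num.sqrt (1 - d%:R * q) <= 1.
      by rewrite -[leRHS]sqrtr1 ler_sqrt// lerBlDr lerDl mulr_ge0// ltW.
    rewrite ler_pM2l ?mulr_gt0 ?exprn_gt0//.
    move: alE al0 al1; set al := Num.sqrt (1 - _); nra.
  (* The right-hand side equals [sigma * d * t / 8], twice what is needed. *)
  + rewrite ge_min; apply/orP; left; rewrite dqE tE -Bqt.
    have : 0 < B * t ^+ 2 * q * d%:R.
      by do 3 (apply: mulr_gt0 => //); rewrite exprn_gt0.
    lra.
- have dV0 : 0 < d%:R^-1 :> R by rewrite invr_gt0.
  have dE : Num.sqrt d%:R^-1 ^+ 2 = d%:R^-1 :> R by rewrite sqr_sqrtr// ltW.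
  apply: (core 0 (Num.sqrt d%:R^-1)) => //.
  + by rewrite sqrtr_gt0.
  + by rewrite dE expr0n/= add0r mulfV// gt_eqF.
  + rewrite (exprM _ 2 2) dE tE.
    have -> : 4 * d%:R^-1 ^+ 2 * B ^+ 2 * t ^+ 2 = (2 * B * t / d%:R) ^+ 2.
      by field; rewrite gt_eqF.
    rewrite ler_sqr ?nnegrE ?divr_ge0 ?mulr_ge0 ?ltW//.
    by rewrite ltr_pdivrMr.
  + rewrite subr0 mulr1 ler_pdivlMr//.
    by have := ler_wpM2r (ltW hB) (ltW large); lra.
  + rewrite ge_min; apply/orP; right; rewrite dE.
    have -> : T%:R * B / d%:R * d%:R / 4 = B * T%:R / 4.
      by field; rewrite gt_eqF.
    by [].
Qed.
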